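(* Let $\Gamma\subset\mathbb{R}^2$ be a simple closed convex curve that is regular and of class $C^2$, and let $\Omega$ be the (nonempty) open domain enclosed by $\Gamma$. Assume that all curvature centers of $\Gamma$ lie in $\Omega$ (in particular, the curvature of $\Gamma$ vanishes nowhere). Then $$L(\Gamma)\;\geq\;\pi\cdot\delta(\Gamma),$$ where $L(\Gamma)$ is the length of $\Gamma$. Equality holds if and only if $\Gamma$ is of constant breadth.
   Context: $\Gamma$ carries the metric $d$ restricted from the Euclidean metric of $\mathbb{R}^2$, and $$\delta(\Gamma):=\inf_{p\in\Gamma}\ \sup_{q\in\Gamma} d(p,q).$$ A closed convex curve is the boundary of a compact convex set with nonempty interior $\Omega$. Orient $\Gamma$ so that $\Omega$ lies to the left, let $\gamma$ be a positively oriented arclength parametrization of $\Gamma$, $T=\gamma'$ the unit tangent, $N$ the inner unit normal and $\kappa$ the curvature, so that $T'=\kappa N$. The curvature centers of $\Gamma$ are the points $\gamma(s)+N(s)/\kappa(s)$; where $\kappa(s)=0$ the curvature center is regarded as infinite, so the assumption that all curvature centers lie in $\Omega$ includes $\kappa>0$ everywhere. $\Gamma$ is of constant breadth if the distance between the two parallel support lines of $\Gamma$ is the same for all directions. *)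

(* Defs.v *)
From mathcomp Require Import all_boot all_order all_algebra.
From mathcomp Require Import all_classical all_reals all_analysis.
Import Order.TTheory GRing.Theory Num.Theory.
Import numFieldNormedType.Exports.

Set Implicit Arguments.
Unset Strict Implicit.
Unset Printing Implicit Defensive.

Local Open Scope classical_set_scope.
Local Open Scope ring_scope.

Section euclidean_plane.
Context {R : realType}.
Implicit Types (u v p q : 'rV[R]_2) (A : set 'rV[R]_2).

Definition dot u v : R := \sum_(i < 2) u 0 i * v 0 i.

(* The norm `|v| that the library puts on 'rV[R]_2 is the sup norm: it gives
   the right topology and derivatives, but lengths and distances below are
   measured with this Euclidean norm instead. *)
Definition enorm v : R := Num.sqrt (dot v v).

Definition edist p q : R := enorm (p - q).

(* rotation by +pi/2, i.e. (x, y) |-> (- y, x) *)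
Definition rot90 v : 'rV[R]_2 := \row_i (if i == 0 then - v 0 1 else v 0 0).

Definition boundary A : set 'rV[R]_2 := closure A `\` interior A.

Definition delta A : R :=
  inf [set sup [set edist p q | q in A] | p in A].

(* For a unit vector u the support line of A with outer normal u is
   {x | dot x u = support_fun A u}; the parallel one has outer normal - u,
   so their distance is the breadth below. *)
Definition support_fun A u : R := sup [set dot x u | x in A].

Definition breadth A u : R := support_fun A u + support_fun A (- u).

Definition constant_breadth A : Prop :=
  exists w : R, forall u, enorm u = 1 -> breadth A u = w.

End euclidean_plane.

(* A closed plane curve is given by a periodic map c on the real line, of
   period l; c is any regular parameter, not necessarily arclength. *)
Section plane_curves.
Context {R : realType}.
Implicit Types (c : R -> 'rV[R]_2) (l t : R) (Omega : set 'rV[R]_2).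

Definition regular_C2 c : Prop :=
  [/\ forall t, derivable c t 1,
      forall t, derivable (derive1 c) t 1,
      continuous (derive1 (derive1 c))
    & forall t, derive1 c t != 0].

Definition simple_closed c l : Prop :=
  [/\ 0 < l, periodic c l & {in `[0, l[ &, injective c}].

Definition speed c t : R := enorm (derive1 c t).

Definition curve_length c l : R :=
  \int[lebesgue_measure]_(t in `[0, l]) speed c t.

Definition tangent c t : 'rV[R]_2 := (speed c t)^-1 *: derive1 c t.

Definition normal c t : 'rV[R]_2 := rot90 (tangent c t).

(* kappa in dT/ds = kappa N, where d/ds = (speed c)^-1 d/dt *)
Definition curvature c t : R :=
  dot ((speed c t)^-1 *: derive1 (tangent c) t) (normal c t).

(* meaningful only where the curvature is nonzero *)
Definition curvature_center c t : 'rV[R]_2 :=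
  c t + (curvature c t)^-1 *: normal c t.

(* Omega lies to the left of c, so that normal c is the inner normal *)
Definition positively_oriented Omega c : Prop :=
  forall t, \forall e \near 0^'+, Omega (c t + e *: normal c t).

End plane_curves.

(* Main.v *)
(* Let k be the curvature times the speed, so that T' = k N, and fix p on the
   curve. At a critical point c t <> p of the distance to p, the point p lies on
   the inner normal at c t, beyond the curvature center because the center is
   interior; hence c t is a strict local maximum. As two such maxima would
   enclose a minimum, c t is the farthest point from p, and the chord from p to
   c t gives delta <= |p - c t| <= breadth in the direction N t. It also makes
   support points unique, so that the normal turns exactly once. Cauchy's
   formula then expresses the length as the integral of the breadth over [0, pi],
   whence the inequality; equality forces the breadth to be constantly delta.
   Conversely, if the breadth is constantly w, every point of the curve has
   another one at distance at least w, so w <= delta. *)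
Require Import Defs.
From mathcomp Require Import all_boot all_order all_algebra.
From mathcomp Require Import all_classical all_reals all_analysis.
From mathcomp Require Import ring lra.
Import Order.TTheory GRing.Theory Num.Theory.
Import numFieldNormedType.Exports.
Set Implicit Arguments.
Unset Strict Implicit.
Unset Printing Implicit Defensive.
Local Open Scope classical_set_scope.
Local Open Scope ring_scope.

(** * Euclidean geometry of the plane in coordinates *)

Section plane_vectors.
Context {R : realType}.
Implicit Types (u v w p q x y z : 'rV[R]_2) (a b r t : R).

Lemma dotE u v : dot u v = u 0 0 * v 0 0 + u 0 1 * v 0 1.
Proof.
rewrite /dot !big_ord_recl big_ord0 addr0.
by congr (_ + u 0 _ * v 0 _); exact/val_inj.
Qed.

Lemma row2_eq u v : u 0 0 = v 0 0 -> u 0 1 = v 0 1 -> u = v.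
Proof.
move=> uv0 uv1; apply/rowP => i; have [->//|->//] : i = 0 \/ i = 1.
by case: i => [[|[|//]] i2]; [left|right]; exact/val_inj.
Qed.

Lemma dotC u v : dot u v = dot v u.
Proof. by rewrite !dotE mulrC (mulrC (u 0 1)). Qed.

Lemma dotDl u v w : dot (u + v) w = dot u w + dot v w.
Proof. by rewrite !dotE !mxE; ring. Qed.

Lemma dotNl u v : dot (- u) v = - dot u v.
Proof. by rewrite !dotE !mxE; ring. Qed.

Lemma dotBl u v w : dot (u - v) w = dot u w - dot v w.
Proof. by rewrite dotDl dotNl. Qed.

Lemma dotZl a u v : dot (a *: u) v = a * dot u v.
Proof. by rewrite !dotE !mxE; ring. Qed.

Lemma dotDr u v w : dot u (v + w) = dot u v + dot u w.
Proof. by rewrite dotC dotDl !(dotC u). Qed.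

Lemma dotNr u v : dot u (- v) = - dot u v.
Proof. by rewrite dotC dotNl dotC. Qed.

Lemma dotBr u v w : dot u (v - w) = dot u v - dot u w.
Proof. by rewrite dotDr dotNr. Qed.

Lemma dotZr a u v : dot u (a *: v) = a * dot u v.
Proof. by rewrite dotC dotZl dotC. Qed.

Lemma dot_scaleB a u v : dot (a *: u - v) (a *: u - v) =
  a ^+ 2 * dot u u - (a * dot u v) *+ 2 + dot v v.
Proof. by rewrite !dotE !mxE; ring. Qed.

Lemma dot_ge0 u : 0 <= dot u u.
Proof. by rewrite dotE; nra. Qed.

Lemma dot_gt0 u : u != 0 -> 0 < dot u u.
Proof.
move=> u0; rewrite lt_def dot_ge0 andbT; apply: contra u0 => /eqP.
rewrite dotE => h; apply/eqP; apply: row2_eq; rewrite mxE; nra.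
Qed.

Lemma enorm_eq1 u : (enorm u = 1) <-> dot u u = 1.
Proof.
split=> [|uu]; last by rewrite /enorm uu sqrtr1.
by move=> u1; rewrite -(sqr_sqrtr (dot_ge0 u)) -/(enorm u) u1 expr1n.
Qed.

Lemma enorm_le u a : 0 <= a -> (enorm u <= a) = (dot u u <= a ^+ 2).
Proof.
by move=> a0; rewrite /enorm -{1}(ger0_norm a0) -sqrtr_sqr ler_sqrt// sqr_ge0.
Qed.

Lemma dot_le_enorm u v : dot v v = 1 -> dot u v <= enorm u.
Proof.
move=> v1; have [|/ltW uv0] := leP (dot u v) 0.
  by move=> /le_trans; apply; exact: sqrtr_ge0.
rewrite -(ger0_norm uv0) -sqrtr_sqr /enorm ler_sqrt ?dot_ge0//.
rewrite -[leRHS]mulr1 -v1 !dotE -subr_ge0.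
(* Lagrange's identity: the gap in Cauchy-Schwarz is the square of the determinant. *)
rewrite (_ : _ - _ = (u 0 0 * v 0 1 - u 0 1 * v 0 0) ^+ 2) ?sqr_ge0//; ring.
Qed.

Lemma dot_continuous u : continuous (fun x => dot x u).
Proof.
rewrite (_ : (fun x => _) = fun x => x 0 0 * u 0 0 + x 0 1 * u 0 1); last first.
  by apply/funext => x; rewrite dotE.
move=> x; apply: (@cvgD _ _ _ (nbhs x) _
  (fun x => x 0 0 * u 0 0) (fun x => x 0 1 * u 0 1)).
  apply: (@cvgMr_tmp _ _ (nbhs x) _ (fun x : 'rV[R]_2 => x 0 0)).
  exact: coord_continuous.
apply: (@cvgMr_tmp _ _ (nbhs x) _ (fun x : 'rV[R]_2 => x 0 1)).
exact: coord_continuous.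
Qed.

(** Directions are indexed by real angles, so that one-variable calculus applies to functions of a
    direction. *)
Definition polar t : 'rV[R]_2 := \row_i (if i == 0 then cos t else sin t).

Lemma polar0 t : polar t 0 0 = cos t. Proof. by rewrite mxE. Qed.

Lemma polar1 t : polar t 0 1 = sin t. Proof. by rewrite mxE. Qed.

Lemma dot_polar t : dot (polar t) (polar t) = 1.
Proof. by rewrite dotE polar0 polar1 -!expr2 cos2Dsin2. Qed.

Lemma polarDpi t : polar (t + pi) = - polar t.
Proof. by apply: row2_eq; rewrite !mxE/= ?cosDpi ?sinDpi. Qed.

Lemma polar_surj u : dot u u = 1 -> exists2 t, - pi <= t <= pi & u = polar t.
Proof.
rewrite dotE => u1; have u0 : -1 <= u 0 0 <= 1 by nra.
have s1 : sin (acos (u 0 0)) = `|u 0 1|.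
  rewrite sin_acos// -sqrtr_sqr; congr Num.sqrt; lra.
have a0 := acos_ge0 u0; have api := acos_lepi u0.
have [u10|u10] := leP 0 (u 0 1).
  exists (acos (u 0 0)); first lra.
  by apply: row2_eq; rewrite ?polar0 ?polar1 ?acosK// s1 ger0_norm.
exists (- acos (u 0 0)); first lra.
apply: row2_eq; rewrite ?polar0 ?polar1 ?cosN ?sinN ?acosK//.
by rewrite s1 ltr0_norm// opprK.
Qed.

Lemma dot_le_row2 u v a b : `|u 0 0| <= a -> `|u 0 1| <= a ->
  `|v 0 0| <= b -> `|v 0 1| <= b -> dot u v <= (a * b) *+ 2.
Proof.
move=> u0 u1 v0 v1; rewrite dotE mulr2n.
apply: lerD; apply: (le_trans (ler_norm _)); rewrite normrM; exact: ler_pM.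
Qed.

(** The topology comes from the sup norm, so basic neighbourhoods are squares. *)
Lemma interior_row2P (K : set 'rV[R]_2) x :
  interior K x <->
  exists2 r, 0 < r & forall y, `|(y - x) 0 0| < r -> `|(y - x) 0 1| < r -> K y.
Proof.
split.
  move=> /nbhs_ballP[r /= r0 rK]; exists r => // y y0 y1; apply: rK.
  split=> // i j; rewrite (ord1 i) -ball_normE/= distrC.
  have [->|->] : j = 0 \/ j = 1.
    by case: j => [[|[|//]] i2]; [left|right]; exact/val_inj.
  - by move: y0; rewrite !mxE.
  - by move: y1; rewrite !mxE.
move=> [r r0 rK]; apply/nbhs_ballP; exists r => // y [_ xy].
by apply: rK; have := xy 0; rewrite -ball_normE/= => h; rewrite !mxE distrC; exact: h.
Qed.

End plane_vectors.

(** * Compact convex sets: support points, separation, supporting lines *)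

Section convex_body.
Context {R : realType} (K : set 'rV[R]_2).
Hypotheses (K_compact : compact K) (K_convex : convex_set K).
Implicit Types (u v p q x y z : 'rV[R]_2) (a b r t : R).

Lemma convex_segment x y t : K x -> K y -> 0 <= t <= 1 -> K (x + t *: (y - x)).
Proof.
move=> Kx Ky /andP[t0 t1].
have t01 : Itv.spec (@Itv.num_sem R) (Itv.Real `[0%Z, 1%Z]) t.
  by rewrite /Itv.spec/= /Itv.num_sem/= ger0_real//= in_itv/= t0 t1.
have := @K_convex y x (Itv.mk t01) (mem_set Ky) (mem_set Kx).
rewrite inE => Kt; suff -> : x + t *: (y - x) = t *: y + (1 - t) *: x by exact: Kt.
by rewrite scalerBl scale1r scalerBr addrCA.
Qed.

Lemma interior_step x v : interior K x -> exists2 e, 0 < e & K (x + e *: v).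
Proof.
move=> /interior_row2P[r r0 rK].
set m := 1 + `|v 0 0| + `|v 0 1|.
have m0 : 0 < m by rewrite /m; have := normr_ge0 (v 0 0); have := normr_ge0 (v 0 1); lra.
exists (r / m); first exact: divr_gt0.
have rm : 0 < r / m by exact: divr_gt0.
have e i : `|v 0 i| < m -> `|(x + (r / m) *: v - x) 0 i| < r.
  move=> vm; rewrite addrC addKr mxE normrM gtr0_norm// mulrAC ltr_pdivrMr//.
  by rewrite ltr_pM2l.
apply: rK; apply: e; rewrite /m; have := normr_ge0 (v 0 0); have := normr_ge0 (v 0 1); lra.
Qed.

(** The homothety of center [x] and ratio [t] carries a square around [y] inside [K] to one of
    half-side [t * r], still in [K] by convexity. *)
Lemma interior_segment x y t : K x -> interior K y -> 0 < t <= 1 ->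
  interior K (x + t *: (y - x)).
Proof.
move=> Kx /interior_row2P[r r0 rK] /andP[t0 t1].
apply/interior_row2P; exists (t * r); first exact: mulr_gt0.
move=> w w0 w1.
have -> : w = x + t *: ((y + t^-1 *: (w - (x + t *: (y - x)))) - x).
  by apply: row2_eq; rewrite !mxE; field; rewrite gt_eqF.
apply: convex_segment => //; last by rewrite ltW.
have e i : `|(w - (x + t *: (y - x))) 0 i| < t * r ->
    `|(y + t^-1 *: (w - (x + t *: (y - x))) - y) 0 i| < r.
  move=> wr; rewrite [y + _]addrC addrK mxE normrM gtr0_norm ?invr_gt0//.
  by rewrite mulrC ltr_pdivrMr// mulrC.
by apply: rK; exact: e.
Qed.

Lemma K_closed : closed K.
Proof. by apply: compact_closed => //; exact: norm_hausdorff. Qed.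

Lemma boundaryE x : boundary K x <-> K x /\ ~ interior K x.
Proof. by rewrite /boundary -(closure_id K).1//; exact: K_closed. Qed.

Lemma compact_max_dot (A : set 'rV[R]_2) u : A !=set0 -> compact A ->
  exists2 z, A z & forall x, A x -> dot x u <= dot z u.
Proof.
move=> A0 cA.
have [|z /set_mem Az zmax] := EVT_max_rV A0 cA (f := fun x => dot x u).
  exact/continuous_subspaceT/dot_continuous.
by exists z => // x Ax; apply: zmax; exact: mem_set.
Qed.

(** From an interior point one can still move along [u], which increases the dot product. *)
Lemma max_dot_boundary z u : u != 0 -> K z ->
  (forall x, K x -> dot x u <= dot z u) -> boundary K z.
Proof.
move=> u0 Kz zmax; apply/boundaryE; split => // /interior_step-/(_ u)[e e0 /zmax].
rewrite dotDl dotZl gerDl => h; have := dot_gt0 u0.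
by move/(mulr_gt0 e0); rewrite ltNge h.
Qed.

Lemma exists_support u : K !=set0 -> u != 0 ->
  exists2 z, boundary K z & forall x, K x -> dot x u <= dot z u.
Proof.
move=> K0 u0; have [z Kz zmax] := compact_max_dot u K0 K_compact.
by exists z => //; exact: (max_dot_boundary u0).
Qed.

Lemma support_funE z u : boundary K z ->
  (forall x, K x -> dot x u <= dot z u) -> support_fun (boundary K) u = dot z u.
Proof.
move=> Kz zmax; apply/le_anti/andP; split.
  by apply: ge_sup; [exists (dot z u), z|move=> _ [x /boundaryE[Kx _] <-]; exact: zmax].
apply: ub_le_sup; last by exists z.
by exists (dot z u) => _ [x /boundaryE[Kx _] <-]; exact: zmax.
Qed.

Lemma support_fun_ge x u : u != 0 -> K x -> dot x u <= support_fun (boundary K) u.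
Proof.
move=> u0 Kx; have [|z Kz zmax] := exists_support _ u0; first by exists x.
by rewrite (support_funE Kz zmax); exact: zmax.
Qed.

Lemma K_bounded : exists2 M, 0 < M & forall x, K x -> forall i, `|x 0 i| <= M.
Proof.
have [M [_ hM]] := compact_bounded K_compact.
exists (`|M| + 1); first by have := normr_ge0 M; lra.
move=> x Kx i; have /hM/(_ x Kx) : M < `|M| + 1 by have := ler_norm M; lra.
apply: le_trans; rewrite [leRHS]/Num.Def.normr/= mx_normrE.
exact: (le_bigmax _ (fun ij => `|x ij.1 ij.2|) (0, i)).
Qed.

(** The direction [u] points from [z], the point of [K] nearest to [y], towards [y]. *)
Lemma separation y : K !=set0 -> ~ K y ->
  exists2 u, dot u u = 1 & forall x, K x -> dot x u < dot y u.
Proof.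
move=> K0 Ky.
have [|z /set_mem Kz zmin] := EVT_min_rV K0 K_compact (f := fun x => dot (x - y) (x - y)).
  apply/continuous_subspaceT => x.
  rewrite (_ : (fun x => _) = fun x => dot x x - dot x (y *+ 2) + dot y y); last first.
    by apply/funext => w; rewrite !dotE !mxE; ring.
  apply: (@cvgD _ _ _ (nbhs x) _ (fun x => dot x x - dot x (y *+ 2)) (fun=> dot y y));
    last exact: cvg_cst.
  apply: (@cvgB _ _ _ (nbhs x) _ (fun x => dot x x) (fun x => dot x (y *+ 2)));
    last exact: dot_continuous.
  rewrite (_ : (fun x => dot x x) = fun x => x 0 0 * x 0 0 + x 0 1 * x 0 1); last first.
    by apply/funext => w; rewrite dotE.
  rewrite dotE.
  apply: (@cvgD _ _ _ (nbhs x) _ (fun x => x 0 0 * x 0 0) (fun x => x 0 1 * x 0 1)).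
    apply: (@cvgM _ _ (nbhs x) _ (fun x : 'rV[R]_2 => x 0 0)
      (fun x => x 0 0)); exact: coord_continuous.
  apply: (@cvgM _ _ (nbhs x) _ (fun x : 'rV[R]_2 => x 0 1)
    (fun x => x 0 1)); exact: coord_continuous.
set w := y - z.
have w0 : w != 0 by rewrite subr_eq0; apply/eqP => yz; apply: Ky; rewrite yz.
have ww := dot_gt0 w0.
have key x : K x -> dot (x - z) w <= 0.
  move=> Kx; rewrite leNgt; apply/negP => h.
  (* With A = |x - z|^2 and B = <x - z, w>, moving from [z] towards [x] by t = B / (A + B) changes
     the squared distance to [y] by t (t A - 2 B), which is negative because t A < B. *)
  pose D := dot (x - z) (x - z) + dot (x - z) w.
  have D0 : 0 < D by rewrite /D; have := dot_ge0 (x - z); lra.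
  pose t := dot (x - z) w / D.
  have t0 : 0 < t by exact: divr_gt0.
  have t1 : t <= 1 by rewrite ler_pdivrMr// mul1r /D; have := dot_ge0 (x - z); lra.
  have tK := convex_segment Kz Kx (_ : 0 <= t <= 1).
  have {tK} := zmin _ (mem_set (tK _)); rewrite (ltW t0) t1 => /(_ isT).
  have -> : z + t *: (x - z) - y = t *: (x - z) - w by rewrite /w opprB addrAC addrC addrA addrAC.
  have -> : z - y = - w by rewrite opprB.
  rewrite dot_scaleB dotNl dotNr opprK.
  have tD : t * D = dot (x - z) w by rewrite /t divfK// gt_eqF.
  have := dot_ge0 (x - z).
  move: tD h t0 t1; rewrite /D; set A := dot (x - z) (x - z); set B := dot (x - z) w.
  nra.
exists ((Num.sqrt (dot w w))^-1 *: w).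
  rewrite dotZl dotZr mulrA -invfM -expr2 sqr_sqrtr ?dot_ge0// mulVf// gt_eqF//.
move=> x /key; rewrite !dotZr ltr_pM2l ?invr_gt0 ?sqrtr_gt0//.
rewrite -subr_gt0 -dotBl => h.
have -> : y - x = w - (x - z) by rewrite /w opprB addrA subrK.
by rewrite dotBl; lra.
Qed.

Let H t := support_fun (boundary K) (polar t).

Lemma unit_neq0 u : dot u u = 1 -> u != 0.
Proof.
by move=> u1; apply/eqP => u0; move: u1; rewrite u0 dotE !mxE; lra.
Qed.

Lemma polar_neq0 t : polar t != 0. Proof. exact/unit_neq0/dot_polar. Qed.

(** A support point [z] for the angle [s] bounds [H s - H t] by [dot z (polar s - polar t)], which
    is small since [K] is bounded. *)
Lemma support_fun_polar_continuous : K !=set0 -> continuous H.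
Proof.
move=> K0; have [M M0 hM] := K_bounded.
have lip s t b : `|cos s - cos t| <= b -> `|sin s - sin t| <= b -> H s - H t <= (M * b) *+ 2.
  move=> hc hs; have [z Kz zmax] := exists_support K0 (polar_neq0 s).
  have [Kz' _] := (boundaryE _).1 Kz.
  rewrite {1}/H (support_funE Kz zmax).
  have := support_fun_ge (polar_neq0 t) Kz'; rewrite -/(H t) => hz.
  have : dot z (polar s - polar t) <= (M * b) *+ 2.
    apply: dot_le_row2; rewrite ?hM//.
      by rewrite !mxE.
    by rewrite !mxE.
  by rewrite dotBr; lra.
move=> t; apply/cvgrPdist_le => /= e e0.
have eM : 0 < e / (M *+ 2) by rewrite divr_gt0// pmulrn_lgt0.
near=> s.
have hc : `|cos t - cos s| <= e / (M *+ 2).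
  by near: s; move: eM; move: (e / _); apply/cvgrPdist_le; exact: continuous_cos.
have hs : `|sin t - sin s| <= e / (M *+ 2).
  by near: s; move: eM; move: (e / _); apply/cvgrPdist_le; exact: continuous_sin.
have eE : (M * (e / (M *+ 2))) *+ 2 = e by field; rewrite gt_eqF.
rewrite ler_norml; apply/andP; split; last by rewrite -[leRHS]eE; exact: lip.
by rewrite lerNl opprB -[leRHS]eE; apply: lip; rewrite distrC.
Unshelve. all: by end_near. Qed.

(* The minimum of h(u) - <b, u> over unit vectors u is the distance from b to
   the boundary, so it vanishes at boundary points. *)
Lemma supporting_normal (b : 'rV[R]_2) : boundary K b ->
  exists2 u, dot u u = 1 & forall x, K x -> dot x u <= dot b u.
Proof.
move=> /boundaryE[Kb intb]; have K0 : K !=set0 by exists b.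
have pi0 : - pi <= pi :> R by have := pi_ge0 R; lra.
have [|t _ tmin] := @EVT_min R (fun t => H t - dot b (polar t)) _ _ pi0.
  apply/continuous_subspaceT => t.
  rewrite (_ : (fun s => _) = fun s : R => H s - (b 0 0 * cos s + b 0 1 * sin s)); last first.
    by apply/funext => s; rewrite dotE polar0 polar1.
  apply: (@cvgB _ _ _ (nbhs t) _ H); first exact: support_fun_polar_continuous.
  by apply: (@cvgD _ _ _ (nbhs t) _ (fun s => b 0 0 * cos s) (fun s => b 0 1 * sin s));
    apply: cvgMl_tmp; [exact: continuous_cos|exact: continuous_sin].
exists (polar t); first exact: dot_polar.
move=> x Kx; apply: (le_trans (support_fun_ge (polar_neq0 t) Kx)); rewrite -/(H t).
rewrite -subr_le0 leNgt; apply/negP => mu0; apply: intb.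
set mu := H t - dot b (polar t) in mu0 tmin.
(* A point [y] of this square outside [K] would be separated from [K] by some [u], although
   [dot (y - b) u <= mu] and [mu] is at most the support function at [u] minus [dot b u]. *)
apply/interior_row2P; exists (mu / 2); first by rewrite divr_gt0.
move=> y y0 y1; apply: contrapT => Ky.
have [u u1 yu] := separation K0 Ky.
have [s spi us] := polar_surj u1.
have [z /boundaryE[Kz _] zmax] := exists_support K0 (unit_neq0 u1).
have := tmin s; rewrite in_itv/= spi => /(_ isT); rewrite /H -us.
have [z' Kz' zmax'] := exists_support K0 (unit_neq0 u1).
rewrite (support_funE Kz' zmax') => hmu.
have := yu _ ((boundaryE _).1 Kz').1 => hz'.
have : dot (y - b) u <= mu / 2 * 1 *+ 2.
  apply: dot_le_row2; [exact: ltW|exact: ltW|rewrite us polar0|rewrite us polar1].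
    exact: cos_max.
  exact: sin_max.
rewrite dotBl; lra.
Qed.

End convex_body.

(** * The moving frame of a regular curve *)

Section moving_frame.
Context {R : realType}.
Implicit Types (c f g : R -> 'rV[R]_2) (t : R).

Lemma is_derive_coord f t i : derivable f t 1 ->
  is_derive t 1 (fun s => f s 0 i) (derive1 f t 0 i).
Proof.
move=> df; have /derivable_mxP/(_ 0 i) dfi := df.
by rewrite derive1E derive_mx// mxE; exact: derivableP.
Qed.

Lemma is_derive_row2 f (df : 'rV[R]_2) t :
  is_derive t 1 (fun s => f s 0 0) (df 0 0) ->
  is_derive t 1 (fun s => f s 0 1) (df 0 1) -> is_derive t 1 f df.
Proof.
move=> d0 d1; have dfd : derivable f t 1.
  apply/derivable_mxP => i j; rewrite (ord1 i).
  have [->|->] : j = 0 \/ j = 1; last 2 first.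
  - by have [] := d0.
  - by have [] := d1.
  by case: j => [[|[|//]] i2]; [left|right]; exact/val_inj.
constructor => //; rewrite derive_mx//; apply: row2_eq; rewrite mxE; exact: derive_val.
Qed.

Lemma is_derive_dot f g (df dg : 'rV[R]_2) t : is_derive t 1 f df -> is_derive t 1 g dg ->
  is_derive t 1 (fun s => dot (f s) (g s)) (dot df (g t) + dot (f t) dg).
Proof.
move=> hf hg; have [f' df'] := hf; have [g' dg'] := hg.
have f0 := is_derive_coord 0 f'; have f1 := is_derive_coord 1 f'.
have g0 := is_derive_coord 0 g'; have g1 := is_derive_coord 1 g'.
move: f0 f1 g0 g1; rewrite !derive1E df' dg' => f0 f1 g0 g1.
rewrite (_ : (fun s => _) = (fun s => f s 0 0) * (fun s => g s 0 0) +
   (fun s => f s 0 1) * (fun s => g s 0 1)); last first.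
  by apply/funext => s; rewrite dotE.
by apply: is_derive_eq; rewrite !dotE /GRing.scale/=; ring.
Qed.

Variable c : R -> 'rV[R]_2.
Hypothesis c_regular : regular_C2 c.
Local Notation c1 := (derive1 c).
Local Notation c2 := (derive1 c1).
Local Notation v := (speed c).
Local Notation T := (tangent c).
Local Notation N := (normal c).

(** This is det(c', c'') / |c'|^2, the derivative of the tangent angle in the given parameter, i.e.
    curvature times speed. *)
Definition turning_rate t : R :=
  (c1 t 0 0 * c2 t 0 1 - c1 t 0 1 * c2 t 0 0) / v t ^+ 2.

Local Notation k := turning_rate.

Lemma is_derive_curve t : is_derive t 1 c (c1 t).
Proof. by have [d _ _ _] := c_regular; rewrite derive1E; exact: derivableP. Qed.

Lemma is_derive_velocity t : is_derive t 1 c1 (c2 t).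
Proof. by have [_ d _ _] := c_regular; rewrite [c2 t]derive1E; exact: derivableP. Qed.

Lemma speed_gt0 t : 0 < v t.
Proof. by have [_ _ _ c0] := c_regular; rewrite sqrtr_gt0 dot_gt0. Qed.

Lemma speed_sqr t : v t ^+ 2 = dot (c1 t) (c1 t).
Proof. by rewrite sqr_sqrtr ?dot_ge0. Qed.

Lemma is_derive_speed t : is_derive t 1 v (dot (c1 t) (c2 t) / v t).
Proof.
have h := is_derive_dot (is_derive_velocity t) (is_derive_velocity t).
have v2 : 0 < dot (c1 t) (c1 t) by rewrite -speed_sqr exprn_gt0// speed_gt0.
have hs := is_derive1_sqrt v2.
have := is_derive1_comp hs h => /(@is_derive_eq _ _ _ _ _ _ _ _); apply.
by rewrite -/(enorm _) -/(v t) (dotC (c2 t)); field; rewrite gt_eqF// speed_gt0.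
Qed.

Lemma velocityE t : c1 t = v t *: T t.
Proof. by rewrite scalerA divff ?scale1r// gt_eqF// speed_gt0. Qed.

Lemma dot_tangent t : dot (T t) (T t) = 1.
Proof.
by rewrite dotZl dotZr -speed_sqr; field; rewrite gt_eqF// speed_gt0.
Qed.

Lemma normal0 t : N t 0 0 = - T t 0 1. Proof. by rewrite mxE. Qed.

Lemma normal1 t : N t 0 1 = T t 0 0. Proof. by rewrite mxE. Qed.

Lemma dot_normal t : dot (N t) (N t) = 1.
Proof. by rewrite -(dot_tangent t) !dotE normal0 normal1; ring. Qed.

Lemma dot_tangent_normal t : dot (T t) (N t) = 0.
Proof. by rewrite !dotE normal0 normal1; ring. Qed.

Lemma frame_decomp t u : u = dot u (T t) *: T t + dot u (N t) *: N t.
Proof.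
move: (normal0 t) (normal1 t) (dot_tangent t).
move: (T t) (N t) => a b b0 b1; rewrite dotE => aa.
by apply: row2_eq; rewrite !dotE !mxE b0 b1 -[LHS]mulr1 -aa; ring.
Qed.

(** On the left is the first coordinate of the derivative of c' / |c'|, on the right that of
    [k t *: N t]; they differ by a multiple of w^2 - |c'|^2. *)
Let quotient_derive_identity (x1 y1 x2 y2 w : R) : w != 0 ->
  w ^+ 2 = x1 * x1 + y1 * y1 ->
  x2 / w - x1 * ((x1 * x2 + y1 * y2) / w) / w ^+ 2 =
  (x1 * y2 - y1 * x2) / w ^+ 2 * - (w^-1 * y1).
Proof.
move=> w0 ww; apply/eqP; rewrite -subr_eq0; apply/eqP.
transitivity ((w ^+ 2 - (x1 * x1 + y1 * y1)) * x2 / w ^+ 3); first by field.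
by rewrite ww subrr !mul0r.
Qed.

Lemma is_derive_tangent t : is_derive t 1 T (k t *: N t).
Proof.
have vN0 : v t != 0 by rewrite gt_eqF// speed_gt0.
have dv := is_derive_speed t.
have [d _] := is_derive_velocity t.
have e i : is_derive t 1 (fun s => T s 0 i)
    (c2 t 0 i / v t - c1 t 0 i * (dot (c1 t) (c2 t) / v t) / v t ^+ 2).
  rewrite (_ : (fun s => _) = (fun s => (v s)^-1) * (fun s => c1 s 0 i)); last first.
    by apply/funext => s; rewrite mxE.
  have di := is_derive_coord i d.
  have dV := is_deriveV vN0 dv.
  by apply: is_derive_eq; rewrite /GRing.scale/=; field.
have vv := speed_sqr t; rewrite dotE in vv.
have T0 : T t 0 0 = (v t)^-1 * c1 t 0 0 by rewrite mxE.
have T1 : T t 0 1 = (v t)^-1 * c1 t 0 1 by rewrite mxE.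
apply: is_derive_row2; apply: (is_derive_eq (e _)); rewrite mxE dotE.
  rewrite normal0 T1 /k; exact: quotient_derive_identity.
(* The second coordinate is the same identity with the coordinates exchanged, which reverses the
   sign of the determinant. *)
have := @quotient_derive_identity _ (c1 t 0 0) (c2 t 0 1) (c2 t 0 0) _ vN0.
rewrite normal1 T0 /k => /(_ (c1 t 0 1)); rewrite addrC => /(_ vv).
by rewrite [X in _ * (X / v t)]addrC => ->; ring.
Qed.

Lemma curvatureE t : curvature c t = k t / v t.
Proof.
have [_] := is_derive_tangent t; rewrite -derive1E => dT.
by rewrite /curvature dT dotZl dotZl dot_normal mulr1 mulrC.
Qed.

Lemma is_derive_continuous (f : R -> R) df : (forall t, is_derive t 1 f (df t)) -> continuous f.
Proof. by move=> d t; apply/differentiable_continuous/derivable1_diffP; have [] := d t. Qed.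

Lemma speed_continuous : continuous v.
Proof. exact: is_derive_continuous is_derive_speed. Qed.

Lemma turning_rate_continuous : continuous k.
Proof.
have [_ d1 d2 _] := c_regular.
have c1i i : continuous (fun t => c1 t 0 i).
  exact: (is_derive_continuous (fun t => is_derive_coord i (d1 t))).
have c2i i : continuous (fun t => c2 t 0 i).
  move=> t; apply: (@continuous_comp _ _ _ c2 (fun x : 'rV[R]_2 => x 0 i)); first exact: d2.
  exact: coord_continuous.
have cM i j : continuous (fun t => c1 t 0 i * c2 t 0 j).
  move=> t; apply: (@cvgM _ _ (nbhs t) _ (fun t => c1 t 0 i)).
    exact: c1i.
  exact: c2i.
move=> t; apply: (@cvgM _ _ (nbhs t) _
  (fun t => c1 t 0 0 * c2 t 0 1 - c1 t 0 1 * c2 t 0 0) (fun t => (v t ^+ 2)^-1)).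
  by apply: (@cvgB _ _ _ (nbhs t)); exact: cM.
apply: cvgV.
  by rewrite gt_eqF// exprn_gt0// speed_gt0.
rewrite (_ : (fun t => v t ^+ 2) = v * v); last by apply/funext => s.
by apply: cvgM; exact: speed_continuous.
Qed.

End moving_frame.

(** * One-variable calculus on rays, and critical points *)

Section real_calculus.
Context {R : realType}.
Implicit Types (f g q : R -> R) (a x y s t m l d : R).

Lemma derive_neg_decreases q d m : is_derive m 1 q d -> d < 0 ->
  exists2 e, 0 < e & (forall s, m < s < m + e -> q s < q m) /\
                     (forall s, m - e < s < m -> q m < q s).
Proof.
move=> [dq <-] d0.
have /cvgr_lt/(_ _ d0) : (fun h => h^-1 *: ((q \o shift m) (h *: 1) - q m)) @ 0^' --> 'D_1 q m.
  exact: dq.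
move=> [e /= e0 he]; exists e => //.
have {}he s : s != m -> `|s - m| < e -> (s - m)^-1 * (q s - q m) < 0.
  move=> sm se; have := he (s - m); rewrite /= sub0r normrN => /(_ se).
  by rewrite subr_eq0 sm => /(_ isT); rewrite /shift/= -[_ *: 1]/(_ * 1) mulr1 subrK.
split=> s /andP[s1 s2].
  have sm : 0 < s - m by rewrite subr_gt0.
  have := he s; rewrite gt_eqF// gtr0_norm// ltrBlDl => /(_ isT s2).
  by rewrite pmulr_rlt0 ?invr_gt0// subr_lt0.
have sm : s - m < 0 by rewrite subr_lt0.
have := he s; rewrite lt_eqF// ltr0_norm// opprB => /(_ isT).
rewrite nmulr_rlt0 ?invr_lt0// subr_gt0; apply; lra.
Qed.

Let gtr_pred s : s - 1 < s. Proof. by rewrite ltrBlDr ltrDl. Qed.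

(** Derivatives are required only beyond [a]: a primitive built as an integral from [a] provides no
    more. *)
Lemma derive_continuous_segment f df a x y :
  (forall t, a < t -> is_derive t 1 f (df t)) -> a < x ->
  {within `[x, y], continuous f}.
Proof.
move=> hf ax; apply: derivable_within_continuous => t.
rewrite in_itv/= => /andP[xt _].
by have [] := hf t (lt_le_trans ax xt).
Qed.

Lemma MVT_ray f df a x y : (forall t, a < t -> is_derive t 1 f (df t)) ->
  a < x -> x < y -> exists2 z, x < z < y & f y - f x = df z * (y - x).
Proof.
move=> hf ax xy; have [t|z|z] := @MVT _ f df x y xy.
- by rewrite in_itv/= => /andP[xt _]; apply: hf; exact: lt_trans xt.
- exact: (derive_continuous_segment hf ax).
- by rewrite in_itv/= => zxy zE; exists z.
Qed.

Lemma derive0_ray f a : (forall t, a < t -> is_derive t 1 f 0) ->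
  forall x y, a < x -> a < y -> f x = f y.
Proof.
move=> hf; suff h x y : a < x -> x < y -> f x = f y.
  by move=> x y ax ay; have [/h->|/h->|->] := ltgtP x y.
move=> ax xy; have [z _] := MVT_ray hf ax xy.
by rewrite mul0r => /eqP; rewrite subr_eq0 => /eqP.
Qed.

(** The factor [q] passes from positive to negative at [m], and [w] preserves its sign. In the
    application [f] is a squared distance and [w] twice the speed. *)
Lemma strict_local_max f q w m d :
  (forall t, is_derive t 1 f (w t * q t)) -> (forall t, 0 < w t) ->
  is_derive m 1 q d -> d < 0 -> q m = 0 ->
  exists2 e, 0 < e & forall s, s != m -> m - e < s < m + e -> f s < f m.
Proof.
move=> hf w0 dq d0 qm; have [e e0 [hr hl]] := derive_neg_decreases dq d0.
exists e => // s; rewrite neq_lt => /orP[sm|ms] /andP[s1 s2].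
  have [z /andP[z1 z2] zE] := @MVT_ray _ _ (s - 1) _ _ (fun t _ => hf t) (gtr_pred s) sm.
  rewrite -subr_gt0 zE mulr_gt0 ?subr_gt0// mulr_gt0// -qm hl//; lra.
have [z /andP[z1 z2] zE] := @MVT_ray _ _ (m - 1) _ _ (fun t _ => hf t) (gtr_pred m) ms.
rewrite -subr_lt0 zE pmulr_llt0 ?subr_gt0// pmulr_rlt0// -qm hr//; lra.
Qed.

(* Between two strict local maxima there is an interior minimum, i.e. a
   critical point that is not a local maximum. *)
Lemma critical_maxima_global f df x y :
  (forall t, is_derive t 1 f (df t)) ->
  (forall m, x < m < y -> df m = 0 -> exists2 e, 0 < e &
     forall s, s != m -> m - e < s < m + e -> f s < f m) ->
  forall t s, df t = 0 -> x < t < y -> x < s < y -> f s <= f t.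
Proof.
move=> hf hmax t s dt /andP[xt ty] /andP[xs sy].
have cf a b : {within `[a, b], continuous f}.
  by apply: derivable_within_continuous => u _; have [] := hf u.
have fermat a b m : a < m < b -> (forall u, a < u < b -> f m <= f u) -> df m = 0.
  move=> mab hm; have [|u _||u|_] := @derive1_at_min _ f a b m.
  - by case/andP: mab => am /(lt_trans am)/ltW.
  - by have [] := hf u.
  - by rewrite in_itv.
  - by rewrite in_itv; exact: hm.
  - by have [_ <-] := hf m.
have [//|ft] := leP (f s) (f t).
have st : s != t by apply: contraTneq ft => ->; rewrite ltxx.
have [] := hmax t _ dt; first by rewrite xt.
move=> e e0 he.
(* A minimum strictly below both end values is interior, hence critical, hence a strict local
   maximum by [hmax]; a nearby [u] contradicts this. *)
have contra a b m : x < a -> b < y -> a <= m <= b -> 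
    (forall u, a <= u <= b -> f m <= f u) -> f m < f a -> f m < f b -> False.
  move=> xa yb /andP[am mb] hm fa fb.
  have am' : a < m by rewrite lt_neqAle am andbT; apply: contraTneq fa => ->; rewrite ltxx.
  have mb' : m < b by rewrite lt_neqAle mb andbT; apply: contraTneq fb => ->; rewrite ltxx.
  have dm : df m = 0.
    by apply: (fermat a b); rewrite ?am'// => u /andP[au ub]; apply: hm; rewrite !ltW.
  have [|e' e'0 he'] := hmax m _ dm; first by rewrite (lt_trans xa am') (lt_trans mb' yb).
  pose u := m + Num.min e' (b - m) / 2.
  have mn0 : 0 < Num.min e' (b - m) by rewrite lt_min e'0 subr_gt0.
  have [m1 m2] : Num.min e' (b - m) <= e' /\ Num.min e' (b - m) <= b - m.
    by split; rewrite ge_min lexx ?orbT.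
  have mu : m < u by rewrite /u; lra.
  have : f u < f m by apply: he'; [rewrite gt_eqF|rewrite /u; lra].
  by rewrite ltNge hm// /u; lra.
(* If [f t < f s], then [f] falls below [f t] on the side of [s], so its minimum between the two is
   strictly below both ends. *)
move: st; rewrite neq_lt => /orP[st|ts].
- have [m] := EVT_min (ltW st) (cf s t); rewrite in_itv/= => mst hm.
  pose u := t - Num.min e (t - s) / 2.
  have mn0 : 0 < Num.min e (t - s) by rewrite lt_min e0 subr_gt0.
  have [m1 m2] : Num.min e (t - s) <= e /\ Num.min e (t - s) <= t - s.
    by split; rewrite ge_min lexx ?orbT.
  have fu : f u < f t by apply: he; [rewrite lt_eqF// /u; lra|rewrite /u; lra].
  have fm : f m < f t.
    by apply: le_lt_trans fu; apply: hm; rewrite in_itv/= /u; lra.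
  exfalso; apply: (contra s t m) => //.
  exact: lt_trans fm ft.
- have [m] := EVT_min (ltW ts) (cf t s); rewrite in_itv/= => mts hm.
  pose u := t + Num.min e (s - t) / 2.
  have mn0 : 0 < Num.min e (s - t) by rewrite lt_min e0 subr_gt0.
  have [m1 m2] : Num.min e (s - t) <= e /\ Num.min e (s - t) <= s - t.
    by split; rewrite ge_min lexx ?orbT.
  have fu : f u < f t by apply: he; [rewrite gt_eqF// /u; lra|rewrite /u; lra].
  have fm : f m < f t.
    by apply: le_lt_trans fu; apply: hm; rewrite in_itv/= /u; lra.
  exfalso; apply: (contra t s m) => //.
  exact: lt_trans fm ft.
Qed.

Lemma is_derive_translate f a x d : is_derive (x + a) 1 f d ->
  is_derive x 1 (fun y => f (y + a)) d.
Proof.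
move=> df; have := @is_derive1_comp _ f (shift a) x d 1 df (is_derive_shift x 1 a).
by rewrite mulr1.
Qed.

Lemma antiderivative_ray f a : continuous f ->
  exists F, forall t, a < t -> is_derive t 1 F (f t).
Proof.
move=> cf; exists (fun x => \int[lebesgue_measure]_(t in `[a, x]) f t) => t ta.
have [||] := @continuous_FTC1_closed R f a t (t + 1) _ _ ta (cf t); first by rewrite ltrDl.
  apply: continuous_compact_integrable; first exact: segment_compact.
  exact: continuous_subspaceT.
by move=> d <-; rewrite derive1E; exact: derivableP.
Qed.

Lemma FTC2_ray f F a x y : continuous f ->
  (forall t, a < t -> is_derive t 1 F (f t)) -> a < x -> x < y ->
  \int[lebesgue_measure]_(t in `[x, y]) f t = F y - F x.
Proof.
move=> cf hF ax xy.
rewrite /Rintegral (@continuous_FTC2 _ f F)//.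
- exact: continuous_subspaceT.
- have cF t : a < t -> {for t, continuous F}.
    by move=> at_; apply/differentiable_continuous/derivable1_diffP; have [] := hF t at_.
  split.
  + by move=> t; rewrite in_itv/= => /andP[xt _]; have [] := hF t (lt_trans ax xt).
  + by apply: cvg_at_right_filter; exact: cF.
  + by apply: cvg_at_left_filter; apply: cF; exact: lt_trans xy.
- move=> t; rewrite in_itv/= => /andP[xt _]; rewrite derive1E.
  by have [_ ->] := hF t (lt_trans ax xt).
Qed.

Lemma int_shift_itv s a l : 0 < l -> exists n : int, a <= s + l *~ n < a + l.
Proof.
move=> l0; exists (- Num.floor ((s - a) / l)).
set n := Num.floor _.
have h1 : n%:~R <= (s - a) / l by exact: floor_le.
have h2 : (s - a) / l < n%:~R + 1 by have := floorD1_gt ((s - a) / l); rewrite intrD.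
move: h1 h2; rewrite ler_pdivlMr// ltr_pdivrMr// mulrNz -mulrzl.
lra.
Qed.

End real_calculus.

(** * Chords, farthest points and normals of the curve *)

Section convex_curve.
Context {R : realType} (K : set 'rV[R]_2) (c : R -> 'rV[R]_2) (l : R).
Hypotheses (K_compact : compact K) (K_convex : convex_set K).
Hypotheses (c_regular : regular_C2 c) (c_simple : simple_closed c l).
Hypotheses (c_range : range c = boundary K).
Hypotheses (c_orient : positively_oriented (interior K) c).
Hypotheses (centers :
  forall t, 0 < curvature c t /\ interior K (curvature_center c t)).
Implicit Types (s t m : R) (x p q u : 'rV[R]_2).
Local Notation c1 := (derive1 c).
Local Notation v := (speed c).
Local Notation T := (tangent c).
Local Notation N := (normal c).
Local Notation k := (turning_rate c).

Lemma curve_boundary t : boundary K (c t).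
Proof. by rewrite -c_range; exists t. Qed.

Lemma curve_mem t : K (c t).
Proof. by have /(boundaryE K_compact)[] := curve_boundary t. Qed.

Lemma boundary_param p : boundary K p -> exists t, p = c t.
Proof. by rewrite -c_range => -[t _ <-]; exists t. Qed.

Lemma turning_rate_gt0 t : 0 < k t.
Proof.
have [+ _] := centers t; rewrite curvatureE//.
by rewrite pmulr_lgt0// invr_gt0; exact: speed_gt0.
Qed.

Lemma dot_tangent_extremum t u :
  (forall s, dot (c s) u <= dot (c t) u) -> dot (T t) u = 0.
Proof.
move=> tmax.
have d s : is_derive s 1 (fun s => dot (c s) u) (dot (c1 s) u).
  have := is_derive_dot (is_derive_curve c_regular s) (is_derive_cst u s 1).
  by move/is_derive_eq; apply; rewrite [dot _ 0]dotE !mxE !mulr0 !addr0.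
have [|s _||s _|_] := @derive1_at_max _ (fun s => dot (c s) u) (t - 1) (t + 1) t.
- by lra.
- by have [] := d s.
- by rewrite in_itv/=; lra.
- exact: tmax.
have [_ ->] := d t; rewrite velocityE// dotZl => /eqP.
by rewrite mulf_eq0 gt_eqF ?speed_gt0//= => /eqP.
Qed.

(** At a support point [u] is orthogonal to the tangent, so it is plus or minus [N t]; the
    orientation puts points of [K] on the side of [N t], which decides the sign. *)
Lemma outer_normal_unique t u : dot u u = 1 ->
  (forall x, K x -> dot x u <= dot (c t) u) -> u = - N t.
Proof.
move=> u1 usup.
have Tu : dot (T t) u = 0 by apply: dot_tangent_extremum => s; exact/usup/curve_mem.
have [e [/= e0 /interior_subset eK]] :=
  filter_ex (filterI (nbhs_right_gt (0 : R)) (c_orient t)).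
have uN := frame_decomp c_regular t u.
rewrite (dotC u (T t)) Tu scale0r add0r in uN.
set a := dot u (N t) in uN.
have a0 : a <= 0.
  have := usup _ eK; rewrite dotDl dotZl (dotC (N t)) -/a gerDl.
  by rewrite pmulr_rle0.
have aa : a ^+ 2 = 1.
  by rewrite -u1 uN dotZl dotZr dot_normal// mulr1.
have a1 : a = -1 by nra.
by rewrite uN a1 scaleN1r.
Qed.

Lemma inner_normal t x : K x -> 0 <= dot (x - c t) (N t).
Proof.
move=> Kx; have [u u1 usup] := supporting_normal K_compact K_convex (curve_boundary t).
by have := usup _ Kx; rewrite (outer_normal_unique u1 usup) !dotNr dotBl; lra.
Qed.

(** The quantity is the derivative of [dot (c s - p) (T s)] at [s = t]. If it were nonnegative, [p]
    would be on the inner normal at distance at most the radius of curvature, so on the segment from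
    [c t] to the interior curvature center, hence interior itself. *)
Lemma normal_chord p t : boundary K p -> p != c t -> dot (c t - p) (T t) = 0 ->
  v t - k t * dot (p - c t) (N t) < 0.
Proof.
move=> /(boundaryE K_compact)[Kp intp] pc pT.
have pcN : p - c t = dot (p - c t) (N t) *: N t.
  rewrite {1}(frame_decomp c_regular t (p - c t)).
  by rewrite -opprB dotNl pT oppr0 scale0r add0r.
have r0 := inner_normal t Kp.
set r := dot (p - c t) (N t) in pcN r0 *.
have {}r0 : 0 < r.
  rewrite lt_def r0 andbT; apply: contra pc => /eqP r0'.
  by rewrite -subr_eq0 pcN r0' scale0r.
rewrite ltNge; apply/negP => vkr; apply: intp.
have [_ cen] := centers t; have k0 := turning_rate_gt0 t; have v0 := speed_gt0 c_regular t.
have -> : p = c t + (r * k t / v t) *: (curvature_center c t - c t).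
  rewrite /curvature_center curvatureE// addrAC subrr add0r scalerA invf_div.
  have -> : r * k t / v t * (v t / k t) = r by field; rewrite !gt_eqF.
  by rewrite -pcN addrC subrK.
apply: interior_segment => //; first exact: curve_mem.
apply/andP; split; first by rewrite divr_gt0// mulr_gt0.
by rewrite ler_pdivrMr// mul1r; lra.
Qed.

Lemma curve_shift s (n : int) : c (s + l *~ n) = c s.
Proof.
have [_ cl _] := c_simple.
have hn (j : nat) r : c (r + l *+ j) = c r.
  by elim: j r => [|j IH] r; rewrite ?mulr0n ?addr0// mulrSr addrA cl IH.
case: n => j; first by rewrite -pmulrn hn.
by rewrite NegzE mulrNz -pmulrn -[in RHS](subrK (l *+ j.+1) s) hn.
Qed.

(** Reduced modulo [l] to [[0, l[], both parameters agree by injectivity, so they differ by a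
    multiple of [l]. *)
Lemma curve_eq_gap s t : c s = c t -> s < t -> s + l <= t.
Proof.
move=> cst st; have [l0 _ cinj] := c_simple.
have [n] := int_shift_itv s 0 l0; rewrite add0r => hn.
have [j] := int_shift_itv t 0 l0; rewrite add0r => hj.
have : s + l *~ n = t + l *~ j.
  by apply: cinj; rewrite ?inE/= ?in_itv//= !curve_shift.
move=> e; have e' : t = s + (n - j)%:~R * l by rewrite mulrzl mulrzBr; lra.
rewrite e' lerD2l; move: st; rewrite e' ltrDl pmulr_lgt0// ltr0z.
by rewrite gtz0_ge1 -(ler_int R) => nj; rewrite ler_peMl// ltW.
Qed.

(** Cut the curve open at [p = c r]. On []r - l, r[] it does not return to [p], so each critical
    point of the squared distance to [p] is a strict local maximum, and the one at [t] is global. *)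
Lemma foot_farthest p t : boundary K p -> p != c t -> dot (c t - p) (T t) = 0 ->
  forall x, boundary K x -> dot (x - p) (x - p) <= dot (c t - p) (c t - p).
Proof.
move=> Kp pc pT _ /boundary_param[s0 ->].
have [l0 _ cinj] := c_simple.
have [r0 pE] := boundary_param Kp.
have [n] := int_shift_itv r0 t l0.
have {pE}: p = c (r0 + l *~ n) by rewrite curve_shift.
move: (r0 + _) => r {r0 n} pE /andP[tr rtl].
have {}tr : t < r.
  by rewrite lt_neqAle tr andbT; apply: contraNneq pc => ->; rewrite pE.
have [j] := int_shift_itv s0 (r - l) l0.
rewrite -(curve_shift s0 j); move: (s0 + _) => s {s0 j}.
rewrite subrK => /andP[]; rewrite le_eqVlt => /predU1P[<- _|rs sr].
  (* The left end of the period is [p] itself, at distance zero. *)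
  have -> : c (r - l) = p by rewrite pE -(curve_shift (r - l) 1) mulr1z subrK.
  by rewrite subrr {1}dotE !mxE mul0r addr0 dot_ge0.
pose q s := dot (c s - p) (T s).
have dc (u : R) : is_derive u 1 (fun s => c s - p) (c1 u).
  have := is_derive_curve c_regular u => h.
  by apply: is_derive_eq; rewrite subr0.
have df (u : R) : is_derive u 1 (fun s => dot (c s - p) (c s - p)) (v u *+ 2 * q u).
  apply: (is_derive_eq (is_derive_dot (dc u) (dc u))).
  by rewrite (dotC (c1 u)) {1 2}velocityE// dotZr /q mulr2n; ring.
have dq (u : R) : is_derive u 1 q (v u - k u * dot (p - c u) (N u)).
  apply: (is_derive_eq (is_derive_dot (dc u) (is_derive_tangent c_regular u))).
  rewrite velocityE// dotZl dot_tangent// mulr1 dotZr -(opprB p) dotNl.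
  by rewrite mulrN.
have v2 (u : R) : 0 < v u *+ 2 by rewrite pmulrn_lgt0// speed_gt0.
apply: (critical_maxima_global (x := r - l) (y := r) df) => //; last 3 first.
- by rewrite /q pT mulr0.
- by rewrite tr andbT; lra.
- by rewrite rs.
move=> m /andP[rm mr] /eqP; rewrite mulf_eq0 gt_eqF//= => /eqP qm.
apply: (strict_local_max df v2 (dq m)) => //.
apply: normal_chord => //; apply/eqP => pm.
(* A passage through [p] at [m] would precede [r] by less than a period. *)
have := @curve_eq_gap m r; rewrite -pm pE => /(_ erefl mr); lra.
Qed.

(** Take the last point of [K] on the normal line at [c t], in the direction [N t]. The curvature
    center lies on this line too, at positive distance, so [r] is positive. *)
Lemma opposite_point t :
  exists p r, [/\ boundary K p, 0 < r & p = c t + r *: N t].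
Proof.
pose A := K `&` (fun x => dot x (T t)) @^-1` [set a | a = dot (c t) (T t)].
have cA : compact A.
  apply: compact_closedI => //; apply: preimage_closed; last exact: closed_eq.
  by move=> x _; exact: dot_continuous.
have N0 := dot_normal c_regular t; have NT := dot_tangent_normal c t.
have [_ cen] := centers t.
have v0 := speed_gt0 c_regular t; have k0 := turning_rate_gt0 t.
have Ac : A (curvature_center c t).
  split; first exact: interior_subset.
  by rewrite /= /curvature_center dotDl dotZl (dotC (N t)) NT mulr0 addr0.
have [|p [Kp pT] pmax] := compact_max_dot (N t) _ cA; first by exists (curvature_center c t).
rewrite /= in pT.
have pE : p = c t + dot (p - c t) (N t) *: N t.
  rewrite -[LHS](subrK (c t)) addrC {1}(frame_decomp c_regular t (p - c t)).
  by rewrite dotBl pT subrr scale0r add0r.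
exists p, (dot (p - c t) (N t)); split => //.
  apply/(boundaryE K_compact); split => // /interior_step-/(_ (N t))[e e0 eK].
  have : A (p + e *: N t).
    by split => //=; rewrite dotDl dotZl (dotC (N t)) NT mulr0 addr0.
  by move/pmax; rewrite dotDl dotZl N0 mulr1 gerDl leNgt e0.
have := pmax _ Ac; rewrite /curvature_center curvatureE// dotDl dotZl N0 mulr1.
by rewrite dotBl subr_gt0; apply: lt_le_trans; rewrite ltrDl invf_div divr_gt0.
Qed.

(** The chord is normal to the curve at [c t], so [c t] is the point farthest from [p] by
    [foot_farthest]. *)
Lemma opposite_point_farthest t : exists p r, [/\ boundary K p, 0 < r,
  p = c t + r *: N t & forall x, boundary K x -> dot (x - p) (x - p) <= r ^+ 2].
Proof.
have [p [r [Kp r0 pE]]] := opposite_point t.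
have pc : p != c t.
  rewrite pE -subr_eq0 addrAC subrr add0r scaler_eq0 gt_eqF//=.
  exact: (unit_neq0 (dot_normal c_regular t)).
have cp : c t - p = - r *: N t by rewrite pE opprD addNKr scaleNr.
have pT : dot (c t - p) (T t) = 0.
  by rewrite cp dotZl dotC dot_tangent_normal mulr0.
exists p, r; split=> // x /(foot_farthest Kp pc pT).
by rewrite cp dotZl dotZr dot_normal// mulr1 mulrNN.
Qed.

(** Each point is on the inner side of the tangent line at the other, so equal normals put [c s] on
    the tangent line at [c t]. That line meets the disc of radius [r] about [p] only at [c t]. *)
Lemma normal_inj s t : N s = N t -> c s = c t.
Proof.
move=> Nst; have [p [r [Kp r0 pE far]]] := opposite_point_farthest t.
have := far _ (curve_boundary s).
have -> : c s - p = - (r *: N t - (c s - c t)).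
  by rewrite pE opprB opprD addrA.
have Nd : dot (N t) (c s - c t) = 0.
  apply/le_anti; rewrite dotC (inner_normal t (curve_mem s)) andbT.
  have := inner_normal s (curve_mem t).
  by rewrite Nst -(opprB (c s)) dotNl oppr_ge0.
rewrite dotNl dotNr opprK dot_scaleB dot_normal// Nd mulr0 mul0rn subr0 mulr1.
rewrite gerDl => h; apply/eqP; rewrite -subr_eq0; apply/negPn/negP.
by move=> /dot_gt0; rewrite ltNge h.
Qed.

Lemma edist_le_sqr p x a : 0 <= a -> dot (x - p) (x - p) <= a ^+ 2 -> Defs.edist p x <= a.
Proof.
by move=> a0; rewrite /Defs.edist enorm_le// -opprB dotNl dotNr opprK.
Qed.

(** This keeps the suprema in [delta] genuine, as [sup] takes a default value on unbounded sets. *)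
Lemma edist_has_ubound p : boundary K p ->
  has_ubound [set Defs.edist p q | q in boundary K].
Proof.
move=> Kp; have [M M0 hM] := K_bounded K_compact.
have hM' x : boundary K x -> forall i, `|x 0 i| <= M by move=> /(boundaryE K_compact)[/hM].
exists (M *+ 4) => _ [q Kq <-].
have M4 : 0 <= M *+ 4 by rewrite mulrn_wge0// ltW.
have b i : `|(q - p) 0 i| <= M *+ 2.
  by rewrite !mxE (le_trans (ler_normB _ _))// mulr2n lerD// hM'.
apply: edist_le_sqr => //; apply: (le_trans (dot_le_row2 (b 0) (b 1) (b 0) (b 1))).
by rewrite !mulr2n -[M *+ 4]mulr_natr; nra.
Qed.

Lemma edist_ge0 p q : 0 <= Defs.edist p q. Proof. exact: sqrtr_ge0. Qed.

Lemma edist_le_sup p q : boundary K p -> boundary K q ->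
  Defs.edist p q <= sup [set Defs.edist p q | q in boundary K].
Proof.
by move=> Kp Kq; apply: ub_le_sup; [exact: edist_has_ubound|exists q].
Qed.

Lemma support_fun_outer t : support_fun (boundary K) (- N t) = - dot (c t) (N t).
Proof.
rewrite (support_funE K_compact (curve_boundary t)) ?dotNr// => x Kx.
by rewrite dotNr lerN2 -subr_ge0 -dotBl inner_normal.
Qed.

(** The chord length [r] lies between the two: the curve is within [r] of [p], and the breadth is at
    least the chord from [c t] to [p]. *)
Lemma delta_le_breadth t : delta (boundary K) <= breadth (boundary K) (- N t).
Proof.
have [p [r [Kp r0 pE far]]] := opposite_point_farthest t.
apply: (@le_trans _ _ r).
  apply: (@le_trans _ _ (sup [set Defs.edist p q | q in boundary K])).
    apply: ge_inf; last by exists p.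
    exists 0 => _ [q Kq <-].
    exact: le_trans (edist_ge0 q q) (edist_le_sup Kq Kq).
  apply: ge_sup; first by exists (Defs.edist p p), p.
  by move=> _ [q Kq <-]; apply: edist_le_sqr; [exact: ltW|exact: far].
rewrite /breadth opprK support_fun_outer.
have [Kp' _] := (boundaryE K_compact _).1 Kp.
have := support_fun_ge K_compact (unit_neq0 (dot_normal c_regular t)) Kp'.
by rewrite pE dotDl dotZl dot_normal// mulr1; lra.
Qed.

Lemma outer_normal_surj u : dot u u = 1 -> exists t, u = - N t.
Proof.
move=> u1; have [|z /boundary_param[t ->] zmax] := exists_support K_compact _ (unit_neq0 u1).
  by exists (c 0); exact: curve_mem.
by exists t; exact: outer_normal_unique.
Qed.

(** For [p = c t] and a support point [z] in the direction [N t], the projection of [p - z] on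
    [- N t] has length equal to the breadth [w]. *)
Lemma constant_breadth_le_delta w :
  (forall u, enorm u = 1 -> breadth (boundary K) u = w) -> w <= delta (boundary K).
Proof.
move=> hw; apply: lb_le_inf.
  by exists (sup [set Defs.edist (c 0) q | q in boundary K]), (c 0) => //; exact: curve_boundary.
move=> _ [p Kp <-]; have [t pE] := boundary_param Kp.
have N1 := dot_normal c_regular t.
have [|z Kz zmax] := exists_support K_compact _ (unit_neq0 N1).
  by exists (c 0); exact: curve_mem.
apply: le_trans (edist_le_sup Kp Kz).
rewrite -(hw (- N t)); last by apply/enorm_eq1; rewrite dotNl dotNr opprK.
rewrite /breadth opprK support_fun_outer (support_funE K_compact Kz zmax).
rewrite /Defs.edist; apply: le_trans (dot_le_enorm (p - z) (v := - N t) _).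
  by rewrite pE dotNr dotBl; lra.
by rewrite dotNl dotNr opprK.
Qed.

End convex_curve.

(** * Turning angle, Cauchy's formula and the equality case *)

Section cauchy_formula.
Context {R : realType} (K : set 'rV[R]_2) (c : R -> 'rV[R]_2) (l : R).
Hypotheses (K_compact : compact K) (K_convex : convex_set K).
Hypotheses (c_regular : regular_C2 c) (c_simple : simple_closed c l).
Hypotheses (c_range : range c = boundary K).
Hypotheses (c_orient : positively_oriented (interior K) c).
Hypotheses (centers :
  forall t, 0 < curvature c t /\ interior K (curvature_center c t)).
Implicit Types (s t m : R) (p q u : 'rV[R]_2).
Local Notation T := (tangent c).
Local Notation N := (normal c).
Local Notation k := (turning_rate c).
Local Notation H := (fun x : R => support_fun (boundary K) (polar x)).

(** The dot product [S] of [- N s] and [polar (psi s)] is constant because both turn at rate [k]. It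
    is 1 at 0, and unit vectors with dot product 1 coincide. *)
Lemma normal_angle psi : (forall t, -1 < t -> is_derive t 1 psi (k t)) ->
  - N 0 = polar (psi 0) -> forall t, -1 < t -> - N t = polar (psi t).
Proof.
move=> dpsi N0 t t1.
have TT := dot_tangent c_regular.
pose S s := T s 0 1 * cos (psi s) - T s 0 0 * sin (psi s).
have N0E s : (- N s) 0 0 = T s 0 1 by rewrite [LHS]mxE normal0 opprK.
have N1E s : (- N s) 0 1 = - T s 0 0 by rewrite [LHS]mxE normal1.
have S1 : S t = 1.
  have <- : S 0 = 1.
    rewrite /S -N0E -[T 0 0 0]opprK -N1E N0 polar0 polar1.
    by rewrite mulNr opprK -!expr2 cos2Dsin2.
  apply: (derive0_ray (a := -1)) => // s s1.
  have dp := dpsi s s1.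
  have [dT] := is_derive_tangent c_regular s; rewrite -derive1E => dTE.
  have d0 := is_derive_coord 0 dT; have d1 := is_derive_coord 1 dT.
  rewrite dTE [_ 0 0]mxE normal0 in d0; rewrite dTE [_ 0 1]mxE normal1 in d1.
  have dc := is_derive1_comp (is_derive_cos (psi s)) dp.
  have ds := is_derive1_comp (is_derive_sin (psi s)) dp.
  have h := is_deriveB (is_deriveM d1 dc) (is_deriveM d0 ds).
  by apply: (is_derive_eq h); rewrite /GRing.scale/=; ring.
have := TT t; have := cos2Dsin2 (psi t); move: S1; rewrite /S dotE => S1 cs tt.
have /eqP : (T t 0 1 - cos (psi t)) ^+ 2 + (T t 0 0 + sin (psi t)) ^+ 2 = 0 by nra.
rewrite paddr_eq0 ?sqr_ge0// !sqrf_eq0 subr_eq0 addr_eq0 => /andP[/eqP e0 /eqP e1].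
by apply: row2_eq; rewrite ?N0E ?N1E ?polar0 ?polar1// e1 opprK.
Qed.

(** The parameters [0] and [l] give the same point, where the outer normal is unique. *)
Lemma normal_period : N l = N 0.
Proof.
have [l0 cl _] := c_simple.
have c0 : c l = c 0 by rewrite -[l]add0r cl.
apply: oppr_inj; apply/esym.
apply: (outer_normal_unique K_compact c_regular c_range c_orient).
  by rewrite dotNl dotNr opprK dot_normal.
move=> x Kx; rewrite c0 !dotNr lerN2 -subr_ge0 -dotBl.
exact: (inner_normal K_compact K_convex c_regular c_range c_orient).
Qed.

Lemma tangent_period : T l = T 0.
Proof.
apply: row2_eq; first by rewrite -!normal1 normal_period.
by apply: oppr_inj; rewrite -!normal0 normal_period.
Qed.

Lemma turning_increasing psi s t : (forall t, -1 < t -> is_derive t 1 psi (k t)) ->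
  -1 < s -> s < t -> psi s < psi t.
Proof.
move=> dpsi s1 st; have [z _ zE] := MVT_ray dpsi s1 st.
by rewrite -subr_gt0 zE mulr_gt0 ?subr_gt0//; exact: (turning_rate_gt0 c_regular centers).
Qed.

(* By uniqueness of support points the outer normal returns to its initial
   direction only when the curve closes up. *)
Lemma total_turning psi : (forall t, -1 < t -> is_derive t 1 psi (k t)) ->
  - N 0 = polar (psi 0) -> psi l = psi 0 + pi *+ 2.
Proof.
move=> dpsi N0; have [l0 cl _] := c_simple.
have neg1 : -1 < 0 :> R by rewrite ltrN10.
have hN := normal_angle dpsi N0.
have pl : polar (psi l) = polar (psi 0).
  by rewrite -hN ?normal_period// (lt_trans neg1).
have tau0 := turning_increasing dpsi neg1 l0.
have cos1 : cos (psi l - psi 0) = 1.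
  by rewrite cosB -!polar0 -!polar1 pl !polar0 !polar1 -!expr2 cos2Dsin2.
set x := psi l - psi 0 in cos1.
have x0 : 0 < x by rewrite subr_gt0.
suff -> : psi l = x + psi 0.
  suff -> : x = pi *+ 2 by rewrite addrC.
  apply/eqP; rewrite eq_le !leNgt; apply/andP; split; apply/negP.
    move=> px.
    (* After more than a full turn, [psi] would have passed [psi 0 + pi *+ 2] at some [t] strictly
       between [0] and [l]; there the normal is [N 0], so [c t = c 0] too early. *)
    have cpsi : {within `[0, l], continuous psi}.
      exact: (derive_continuous_segment dpsi).
    have [|t] := IVT (v := psi 0 + pi *+ 2) (ltW l0) cpsi.
      rewrite ge_min le_max; apply/andP; split; apply/orP.
        by left; have := pi_gt0 R; rewrite mulr2n; lra.
      by right; rewrite -subr_ge0 /x in px *; lra.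
    rewrite in_itv/= => /andP[t0 tl] pt.
    have {}tl : t < l.
      rewrite lt_neqAle tl andbT; apply: contraTneq px => tl'.
      by rewrite /x -tl' pt addrC addKr ltxx.
    have {}t0 : 0 < t.
      rewrite lt_neqAle t0 andbT; apply/eqP => t0'; move: pt; rewrite -t0'.
      by have := pi_gt0 R; rewrite mulr2n; lra.
    have Nt : N t = N 0.
      apply: oppr_inj; rewrite N0 hN ?pt ?(lt_trans neg1)//.
      by apply: row2_eq; rewrite ?polar0 ?polar1 ?cosD2pi ?sinD2pi.
    have := normal_inj K_compact K_convex c_regular c_simple c_range c_orient centers Nt.
    move/esym/(curve_eq_gap c_simple)/(_ t0); lra.
  (* Less than a full turn contradicts cos x = 1 - 2 sin(x/2)^2. *)
  move=> xp; have : 0 < sin (x / 2).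
    by apply: sin_gt0_pi; rewrite mulr2n in xp; lra.
  have : cos x = 1 - sin (x / 2) ^+ 2 *+ 2.
    by rewrite [in LHS](splitr x) cosD -!expr2 cos2sin2 mulr2n; ring.
  by rewrite cos1; move: (sin _) => y; rewrite mulr2n; nra.
by rewrite subrK.
Qed.

Lemma support_period x : H (x + pi *+ 2) = H x.
Proof.
congr support_fun; apply: row2_eq; rewrite ?polar0 ?polar1.
  exact: cosD2pi.
exact: sinD2pi.
Qed.

(* Cauchy's formula: (V - <c, T>)' = - k <c, N> = k h(-N) is the derivative of
   a primitive of the support function along the turning angle of the normal. *)
Lemma length_support_fun : exists2 F : R -> R,
  (forall x, - pi - 1 < x -> is_derive x 1 F (H x)) &
  forall x, - pi - 1 < x -> F (x + pi *+ 2) - F x = curve_length c l.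
Proof.
have [l0 cl _] := c_simple.
have [V dV] := antiderivative_ray (-1) (speed_continuous c_regular).
have [psi' dpsi'] := antiderivative_ray (-1) (turning_rate_continuous c_regular).
have Nd : dot (- N 0) (- N 0) = 1 by rewrite dotNl dotNr opprK dot_normal.
have [th /andP[th1 th2] thE] := polar_surj Nd.
pose psi t := psi' t - (psi' 0 - th).
have psi0 : psi 0 = th by rewrite /psi; ring.
have dpsi t : -1 < t -> is_derive t 1 psi (k t).
  move=> /dpsi' d; have := is_deriveB d (is_derive_cst (psi' 0 - th) t 1).
  by move/is_derive_eq; apply; rewrite subr0.
rewrite -psi0 in thE th1 th2.
have hN := normal_angle dpsi thE; have psil := total_turning dpsi thE.
have h2 : -1 < - 2^-1 :> R by lra.
(* [F] must be differentiable beyond [- pi - 1], as claimed, and at [psi t] for all [t > -1/2], a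
   ray with 0 in its interior. *)
pose a := Num.min (- pi - 1) (psi (- 2^-1)).
have a1 : a <= - pi - 1 by rewrite ge_min lexx.
have a2 : a <= psi (- 2^-1) by rewrite ge_min lexx orbT.
have cH : continuous H.
  apply: support_fun_polar_continuous => //; exists (c 0).
  exact: (curve_mem K_compact c_range).
have [F dF] := antiderivative_ray a cH.
have pg := pi_gt0 R.
have W t : - 2^-1 < t ->
    is_derive t 1 (fun s => V s - dot (c s) (T s) - F (psi s)) 0.
  move=> ht; have t1 := lt_trans h2 ht.
  have pt : a < psi t by apply: le_lt_trans a2 _; exact: turning_increasing.
  have dVt := dV t t1.
  have dct := is_derive_dot (is_derive_curve c_regular t) (is_derive_tangent c_regular t).
  have dFt := is_derive1_comp (dF _ pt) (dpsi t t1).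
  apply: (is_derive_eq (is_deriveB (is_deriveB dVt dct) dFt)).
  rewrite -hN// (support_fun_outer K_compact K_convex c_regular c_range c_orient).
  by rewrite {1}velocityE// dotZl dot_tangent// dotZr; ring.
have dF' x : - pi - 1 < x -> is_derive x 1 F (H x).
  by move=> hx; apply: dF; apply: le_lt_trans hx.
exists F => // x hx.
(* By periodicity of [H] the increment over a full turn does not depend on its start, so it may
   start at [psi 0]. *)
have -> : F (x + pi *+ 2) - F x = F (psi 0 + pi *+ 2) - F (psi 0).
  apply: (derive0_ray (f := fun x => F (x + pi *+ 2) - F x) (a := - pi - 1)) => //; last by lra.
  move=> y hy; have d1 := dF' _ hy.
  have hy' : - pi - 1 < y + pi *+ 2 by rewrite mulr2n; lra.
  have d2 := is_derive_translate (dF' _ hy').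
  by apply: (is_derive_eq (is_deriveB d2 d1)); rewrite support_period subrr.
rewrite /curve_length (FTC2_ray (speed_continuous c_regular) dV _ l0) ?ltrN10//.
(* Compare the constant at [l] and [0]: the term [dot (c s) (T s)] cancels by periodicity, and [psi]
   gains a full turn. *)
have := derive0_ray W (_ : - 2^-1 < l) (_ : - 2^-1 < 0) => /(_ _ _)/=.
rewrite psil -[l in c l]add0r cl tangent_period.
have hl : - 2^-1 < l by apply: lt_trans l0; lra.
by move/(_ hl); rewrite oppr_lt0 invr_gt0 ltr0n => /(_ isT); lra.
Qed.

Lemma delta_le_breadth_polar x : delta (boundary K) <= breadth (boundary K) (polar x).
Proof.
have [t ->] := outer_normal_surj K_compact c_regular c_range c_orient (dot_polar x).
exact: (delta_le_breadth K_compact K_convex c_regular c_simple c_range c_orient centers).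
Qed.

(** Opposite directions are paired: for [F x + F (x + pi)] an increment over [pi] telescopes to one
    of [F] over a full turn. *)
Lemma length_breadth : exists2 D : R -> R,
  (forall x, - pi - 1 < x -> is_derive x 1 D (breadth (boundary K) (polar x))) &
  forall x, - pi - 1 < x -> D (x + pi) - D x = curve_length c l.
Proof.
have [F dF FL] := length_support_fun; have pg := pi_gt0 R.
exists (fun x => F x + F (x + pi)) => x hx; last first.
  by have := FL x hx; rewrite mulr2n addrA => <-; ring.
have hx' : - pi - 1 < x + pi by lra.
apply: (is_derive_eq (is_deriveD (dF _ hx) (is_derive_translate (dF _ hx')))).
by rewrite /breadth polarDpi.
Qed.

(** The mean value theorem replaces the integral of the breadth by its value in one direction. *)
Lemma length_eq_breadth :
  exists x, curve_length c l = breadth (boundary K) (polar x) * pi.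
Proof.
have [D dD DL] := length_breadth; have pg := pi_gt0 R.
have h0 : - pi - 1 < 0 :> R by lra.
have [|z _ zE] := MVT_ray (x := 0) (y := 0 + pi) dD h0; first by rewrite add0r.
by exists z; rewrite -(DL _ h0) zE addrC addKr.
Qed.

Lemma length_ge : pi * delta (boundary K) <= curve_length c l.
Proof.
have [x ->] := length_eq_breadth.
by rewrite mulrC ler_pM2r ?pi_gt0//; exact: delta_le_breadth_polar.
Qed.

(** [G] is nondecreasing since the breadth is at least [d], and it has period [pi] since the length
    is [pi * d]. So it is maximal at [y], where its derivative, the breadth minus [d], vanishes. *)
Lemma length_eq_constant_breadth :
  curve_length c l = pi * delta (boundary K) -> constant_breadth (boundary K).
Proof.
move=> Leq; exists (delta (boundary K)) => u /enorm_eq1/polar_surj[y /andP[y1 _] ->].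
have [D dD DL] := length_breadth; have pg := pi_gt0 R.
set d := delta (boundary K) in Leq *.
pose G x := D x - d * x.
have dG x : - pi - 1 < x -> is_derive x 1 G (breadth (boundary K) (polar x) - d).
  move=> /dD dx; have := is_deriveB dx (is_deriveZ d (is_derive_id x 1)).
  by move/is_derive_eq; apply; rewrite /GRing.scale/= mulr1.
have G_le x z : - pi - 1 < x -> x <= z -> G x <= G z.
  move=> hx; rewrite le_eqVlt => /predU1P[->//|xz].
  have [w _ wE] := MVT_ray dG hx xz.
  rewrite -subr_ge0 wE mulr_ge0 ?subr_ge0 ?(ltW xz)//.
  exact: delta_le_breadth_polar.
have G_period x : - pi - 1 < x -> G (x + pi) = G x.
  by move=> /DL; rewrite Leq /G; lra.
(* This puts [y] strictly inside []b, b + pi[] while [b] stays beyond [- pi - 1]. *)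
pose b := y - 2^-1; have hb : - pi - 1 < b by rewrite /b; lra.
have [|t||t|_ dG0] := @derive1_at_max _ G b (b + pi) y.
- by lra.
- by rewrite in_itv/= => /andP[bt _]; have [] := dG t (lt_trans hb bt).
- by rewrite in_itv/= /b; have := pi_ge2 R; lra.
- rewrite in_itv/= => /andP[bt /ltW tb].
  apply: (le_trans (G_le _ _ (lt_trans hb bt) tb)).
  by rewrite G_period//; apply: G_le => //; rewrite /b; lra.
have [|_] := dG y; first by lra.
by rewrite dG0 => /esym/eqP; rewrite subr_eq0 => /eqP.
Qed.

Lemma constant_breadth_length_eq : constant_breadth (boundary K) ->
  curve_length c l = pi * delta (boundary K).
Proof.
move=> [w hw]; apply/le_anti; rewrite length_ge andbT.
have [x ->] := length_eq_breadth.
rewrite hw; last exact/enorm_eq1/dot_polar.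
rewrite mulrC ler_pM2l ?pi_gt0//.
exact: (constant_breadth_le_delta K_compact K_convex c_regular c_range c_orient hw).
Qed.

End cauchy_formula.

Unset Implicit Arguments.
Theorem theorem2p1 (R : realType) (K Gamma Omega : set 'rV[R]_2)
    (c : R -> 'rV[R]_2) (l : R)
    (K_compact : compact K) (K_convex : convex_set K)
    (Omega_def : Omega = interior K) (Omega_neq0 : Omega !=set0)
    (Gamma_def : Gamma = boundary K)
    (c_regular : regular_C2 c) (c_simple : simple_closed c l)
    (c_range : range c = Gamma) (c_orient : positively_oriented Omega c)
    (centers : forall t, 0 < curvature c t /\ Omega (curvature_center c t)) :
  curve_length c l >= pi * delta Gamma /\
  (curve_length c l = pi * delta Gamma <-> constant_breadth Gamma).
Proof.
subst Omega Gamma; split; first exact: (length_ge K_compact).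
split; first exact: (length_eq_constant_breadth K_compact).
exact: (constant_breadth_length_eq K_compact).
Qed.
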